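(* Let $K$ be the Knaster continuum, let $\mathcal{U}$ be a non-principal ultrafilter on $\mathbb{N}$, and let $\mathcal{D}=\{D_n\}_{n\in\mathbb{N}}$, $D_n=\{d_{i,n}\}_{i=1}^{k_n}$, be a sequence of chains covering $K$ such that $(0,0)\in d_{1,n}$ for every $n$ and $\mathrm{mesh}(D_n)\to0$ as $n\to\infty$. Then $K$ endowed with the order topology $\tau_{\mathcal{U}}^{\mathcal{D}}$ generated by $\leq_{\mathcal{U}}^{\mathcal{D}}$ is a metrizable, non-connected, non-compact and non-separable space.
   Context: A chain in a metric space $X$ is a finite sequence of open sets $d_1,\dots,d_k$ (its links) with $d_i\cap d_j\neq\varnothing\iff|i-j|\le 1$; its mesh is the maximum of the diameters of its links. $\mathbb{N}=\{1,2,3,\dots\}$. Let $\mathcal{D}=\{D_n\}_{n\in\mathbb{N}}$ be a sequence of chains $D_n=\{d_{1,n},\dots,d_{k_n,n}\}$, each covering $X$, with $\mathrm{mesh}(D_n)\to 0$, and let $\mathcal{U}$ be a non-principal ultrafilter on $\mathbb{N}$. Write $x\leq_{D_n}y$ iff there exist $i\le j\le k_n$ with $x\in d_{i,n}$ and $y\in d_{j,n}$, and $x\leq_{\mathcal{U}}^{\mathcal{D}}y$ iff $\{n\in\mathbb{N}: x\leq_{D_n}y\}\in\mathcal{U}$. This is a linear order on $X$, called an ultrafilter order. Let $\mathcal{C}\subseteq[0,1]\times\{0\}$ be the standard Cantor ternary set. The Knaster continuum is the subspace $K$ of $\mathbb{R}^2$ consisting of: all semicircles with ordinates $\ge0$,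 with center $(\frac12,0)$, passing through points of $\mathcal{C}$; and, for each $n\ge1$, all semicircles with ordinates $\le0$, with center $(\frac{5}{2\cdot3^n},0)$, passing through points of $\mathcal{C}$ lying in the interval $[\frac{2}{3^n},\frac{1}{3^{n-1}}]$. *)

(* Defs.v *)
From HB Require Import structures.
From mathcomp Require Import all_boot all_order all_algebra.
From mathcomp Require Import all_classical all_reals all_analysis.
From mathcomp Require Import lra zify.

Set Implicit Arguments.
Unset Strict Implicit.
Unset Printing Implicit Defensive.

Import Order.TTheory GRing.Theory Num.Theory.
Import numFieldNormedType.Exports.

Local Open Scope classical_set_scope.
Local Open Scope ring_scope.

Definition metrizable (R : realType) (T : topologicalType) : Prop :=
  exists d : T -> T -> R,
    [/\ forall x, d x x = 0,
        forall x y, d x y = 0 -> x = y,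
        forall x y, d x y = d y x,
        forall y x z, d x z <= d x y + d y z &
        forall x : T, nbhs x =
          filter_from [set e : R | 0 < e] (fun e => [set y | d x y < e])].

Definition separable (T : topologicalType) : Prop :=
  exists2 A : set T, countable A & dense A.

Definition nonprincipal (T : Type) (U : set_system T) : Prop :=
  forall x : T, U <> principal_filter x.

(* The library metrizes [R * R] by the sup norm; [plane R] carries the
   Euclidean distance instead. *)
Definition plane (R : realType) : Type := (R * R)%type.

Section plane.
Context {R : realType}.
Implicit Types p q r : plane R.

Definition eucl_dist p q : R :=
  Num.sqrt ((p.1 - q.1) ^+ 2 + (p.2 - q.2) ^+ 2).

Let eucl_distxx p : eucl_dist p p = 0.
Proof. by rewrite /eucl_dist !subrr expr0n addr0 sqrtr0. Qed.

Let eucl_dist_positivity p q : eucl_dist p q = 0 -> p = q.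
Proof.
move=> /eqP; rewrite sqrtr_eq0 => h.
have := sqr_ge0 (p.1 - q.1); have := sqr_ge0 (p.2 - q.2) => h2 h1.
have /eqP : (p.1 - q.1) ^+ 2 = 0 by lra.
have /eqP : (p.2 - q.2) ^+ 2 = 0 by lra.
rewrite !sqrf_eq0 !subr_eq0 => /eqP e2 /eqP e1.
by move: p q {h h1 h2} e1 e2 => [? ?] [? ?] /= -> ->.
Qed.

Let eucl_dist_sym p q : eucl_dist p q = eucl_dist q p.
Proof. by rewrite /eucl_dist -(sqrrN (p.1 - _)) -(sqrrN (p.2 - _)) !opprB. Qed.

Let eucl_dist_triangle q p r : eucl_dist p r <= eucl_dist p q + eucl_dist q r.
Proof.
rewrite /eucl_dist.
have -> : p.1 - r.1 = (p.1 - q.1) + (q.1 - r.1) by lra.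
have -> : p.2 - r.2 = (p.2 - q.2) + (q.2 - r.2) by lra.
move: (p.1 - q.1) (q.1 - r.1) (p.2 - q.2) (q.2 - r.2) => a c b d.
have s1 : 0 <= a ^+ 2 + b ^+ 2 by rewrite addr_ge0 ?sqr_ge0.
have s2 : 0 <= c ^+ 2 + d ^+ 2 by rewrite addr_ge0 ?sqr_ge0.
have := sqrtr_ge0 (a ^+ 2 + b ^+ 2); have := sqrtr_ge0 (c ^+ 2 + d ^+ 2).
have := sqr_sqrtr s1; have := sqr_sqrtr s2.
set s := Num.sqrt (a ^+ 2 + _); set t := Num.sqrt (c ^+ 2 + _).
move=> t2 ss2 t0 s0.
rewrite -[leRHS]ger0_norm ?addr_ge0// -sqrtr_sqr ler_sqrt ?sqr_ge0//.
have st : a * c + b * d <= s * t.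
  rewrite -[leRHS]ger0_norm ?mulr_ge0// -sqrtr_sqr.
  apply: le_trans (ler_norm _) _; rewrite -sqrtr_sqr ler_sqrt ?sqr_ge0//.
  by rewrite exprMn t2 ss2; have := sqr_ge0 (a * d - b * c); nra.
nra.
Qed.

HB.instance Definition _ := Choice.on (plane R).
HB.instance Definition _ := @isMetric.Build R (plane R)
  eucl_dist eucl_distxx eucl_dist_positivity eucl_dist_sym eucl_dist_triangle.

End plane.

Section set_type_metric.
Context {R : realType} {X : metricType R} (A : set X).

Let dist (x y : A) : R := mdist (set_val x) (set_val y).

Let dist_ge0 x y : 0 <= dist x y.
Proof. exact: mdist_ge0. Qed.

Let dist_positivity x y : dist x y = 0 -> x = y.
Proof. by move=> /mdist_positivity; exact: val_inj. Qed.

Let ballEdist (x : A) e : ball x e = [set y | dist x y < e].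
Proof. by rewrite -initial_ballE ballEmdist. Qed.

HB.instance Definition _ := @PseudoMetric_isMetric.Build R (set_type A)
  dist dist_ge0 dist_positivity ballEdist.

End set_type_metric.

Section knaster.
Variable R : realType.

Fixpoint cantor_stage (n : nat) : set R :=
  if n is m.+1 then
    [set x / 3 | x in cantor_stage m] `|` [set (2 + x) / 3 | x in cantor_stage m]
  else `[0, 1].

Definition cantor_ternary : set R := \bigcap_n cantor_stage n.

Definition upper_semicircle (c : R) (q : plane R) : set (plane R) :=
  [set p | mdist ((c, 0) : plane R) p = mdist ((c, 0) : plane R) q /\ 0 <= p.2].

Definition lower_semicircle (c : R) (q : plane R) : set (plane R) :=
  [set p | mdist ((c, 0) : plane R) p = mdist ((c, 0) : plane R) q /\ p.2 <= 0].

Definition knaster_set : set (plane R) :=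
  \bigcup_(a in cantor_ternary) upper_semicircle (1 / 2) (a, 0) `|`
  \bigcup_(n in [set n : nat | (1 <= n)%N])
    \bigcup_(a in cantor_ternary `&` `[2 / 3 ^+ n, 1 / 3 ^+ n.-1])
      lower_semicircle (5 / (2 * 3 ^+ n)) (a, 0).

Definition knaster : Type := set_type knaster_set.
HB.instance Definition _ := Metric.on knaster.

Lemma cantor_ternary0 : cantor_ternary 0.
Proof.
move=> n _; elim: n => [|n IH] /=; first by rewrite in_itv /= lexx ler01.
by left; exists 0 => //; rewrite mul0r.
Qed.

Lemma knaster_set0 : ((0, 0) : plane R) \in knaster_set.
Proof. by apply/mem_set; left; exists 0; [exact: cantor_ternary0 | split]. Qed.

Definition knaster_origin : knaster := exist _ (0, 0) knaster_set0.

End knaster.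

Section chain.
Context {R : realType} {X : metricType R}.

Definition diam (A : set X) : \bar R :=
  ereal_sup [set (mdist xy.1 xy.2)%:E | xy in A `*` A].

(* The links d_1, ..., d_k are numbered [ord0, ..., ord_max] with
   k = [chain_last].+1. *)
Record chain := Chain {
  chain_last : nat;
  link : 'I_chain_last.+1 -> set X;
  link_open : forall i, open (link i);
  link_meet : forall i j : 'I_chain_last.+1,
    link i `&` link j !=set0 <-> (`|(i : nat) - (j : nat)| <= 1)%N
}.
Arguments link : clear implicits.

(* Links are nonempty by [link_meet], so 0 is neutral for their diameters. *)
Definition mesh (C : chain) : \bar R :=
  \big[maxe/0%E]_(i < (chain_last C).+1) diam (link C i).

Definition covers (C : chain) : Prop := \bigcup_i link C i = [set: X].

Definition chain_le (C : chain) (x y : X) : Prop :=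
  exists i j : 'I_(chain_last C).+1, [/\ (i <= j)%N, link C i x & link C j y].

(* Sequences of chains, and [U], are indexed from 0, a mere relabelling of
   N = {1, 2, ...}. *)
Definition ultra_le (U : set_system nat) (D : nat -> chain) (x y : X) : Prop :=
  U [set n | chain_le (D n) x y].

End chain.
Arguments chain {R} X.
Arguments link {R X} _ _.

Section ultra_order.
Context {R : realType} {X : metricType R}.
Variables (U : set_system nat) (D : nat -> chain X).
Hypotheses (UU : UltraFilter U) (npU : nonprincipal U).
Hypothesis cD : forall n, covers (D n).
Hypothesis mD : mesh (D n) @[n --> \oo] --> 0%E.

Let link_dist (C : chain X) (i j : 'I_(chain_last C).+1) x y (e : R) :
  (mesh C < e%:E)%E -> (`|(i : nat) - (j : nat)| <= 1)%N ->
  link C i x -> link C j y -> mdist x y < e + e.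
Proof.
move=> me; have dl k u v : link C k u -> link C k v -> mdist u v < e.
  move=> ku kv; rewrite -lte_fin; apply: le_lt_trans me.
  rewrite /mesh (bigD1 k)//= le_max; apply/orP; left.
  by apply: ereal_sup_ubound; exists (u, v).
move=> /(link_meet i j)[z [iz jz]] ix jy.
apply: le_lt_trans (metric_triangle x z y) _.
by apply: ltrD; [exact: (dl i) | exact: (dl j)].
Qed.

Let U_set1 N : ~ U [set N].
Proof.
move=> UN; case: (npU (x := N)).
apply: (@max_filter _ _ (principal_filter_ultra N) U (@ultra_proper _ _ UU)).
move=> A.
by move=> /principal_filterP AN; apply: (filterS _ UN) => n /= ->.
Qed.

Let U_cofinite : \oo `<=` U.
Proof.
move=> A [N _ NA]; have [//|UnA] := in_ultra_setVsetC A UU.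
have : U `I_N.
  apply: filterS UnA => n nA; apply: contrapT => /negP.
  by rewrite -leqNgt => /NA.
elim: N {NA} => [|N IH]; first by rewrite II0 => /filter_not_empty.
have [/U_set1//|UnN] := in_ultra_setVsetC [set N] UU.
move=> UN; apply: IH; apply: filterS (filterI UN UnN) => n /= [].
by rewrite ltnS leq_eqVlt => /orP[/eqP|].
Qed.

Let U_far x y : x != y -> U [set n | forall i j : 'I_(chain_last (D n)).+1,
  (`|(i : nat) - (j : nat)| <= 1)%N -> link (D n) i x -> ~ link (D n) j y].
Proof.
rewrite -mdist_gt0 => xy; apply: U_cofinite.
have e0 : (0%:E < (mdist x y / 2)%:E)%E by rewrite lte_fin divr_gt0.
have : \forall n \near \oo, (mesh (D n) < (mdist x y / 2)%:E)%E.
  exact: (mD (open_ereal_lt' e0)).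
move=> [N _ h]; exists N => // n /h /= me i j ij ix jy.
by have := link_dist me ij ix jy; rewrite -splitr ltxx.
Qed.

Let ultra_le_refl x : ultra_le U D x x.
Proof.
apply: filterS filterT => n _ /=.
have : (\bigcup_i link (D n) i) x by rewrite cD.
by move=> [i _ ix]; exists i, i.
Qed.

Let ultra_le_anti x y : ultra_le U D x y -> ultra_le U D y x -> x = y.
Proof.
move=> xy yx; apply/eqP/negPn/negP => /U_far far.
have UF : Filter U by apply: filter_filter.
have [n [/= h [[i [j [ij ix jy]]] [i' [j' [ij' iy jx]]]]]] :=
  filter_ex (filterI far (filterI xy yx)).
have a1 : (`|(i : nat) - (j' : nat)| <= 1)%N by apply/link_meet; exists x.
have a2 : (`|(i' : nat) - (j : nat)| <= 1)%N by apply/link_meet; exists y.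
have [ij1|ij2] := leqP j i.+1; first by apply: (h i j) => //; lia.
by apply: (h j' j) => //; lia.
Qed.

Let ultra_le_trans x y z :
  ultra_le U D x y -> ultra_le U D y z -> ultra_le U D x z.
Proof.
have [<-|/U_far far] := eqVneq x z; first by move=> *; exact: ultra_le_refl.
move=> xy yz; apply: filterS (filterI far (filterI xy yz)).
move=> n [/= h [[i [j [ij ix jy]]] [i' [j' [ij' iy jz]]]]].
have a2 : (`|(i' : nat) - (j : nat)| <= 1)%N by apply/link_meet; exists y.
have [le|lt] := leqP i j'; first by exists i, j'.
by exfalso; apply: (h i j') => //; lia.
Qed.

Let ultra_le_total x y : ultra_le U D x y \/ ultra_le U D y x.
Proof.
have [|nxy] := in_ultra_setVsetC [set n | chain_le (D n) x y] UU; first by left.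
right; apply: filterS nxy => n /= nxy.
have : (\bigcup_i link (D n) i) x by rewrite cD.
have : (\bigcup_i link (D n) i) y by rewrite cD.
move=> [j _ jy] [i _ ix]; exists j, i; split => //.
by rewrite leqNgt; apply/negP => /ltnW ij; apply: nxy; exists i, j.
Qed.

(* The carrier X ordered by [ultra_le U D]; the hypotheses are arguments
   because they are what makes this relation a linear order. *)
Definition ultra_ordered of UltraFilter U & nonprincipal U
    & (forall n, covers (D n)) & mesh (D n) @[n --> \oo] --> 0%E : Type := X.

Local Notation T := (ultra_ordered UU npU cD mD).

HB.instance Definition _ := Choice.on T.

Let leT (x y : T) : bool := `[< ultra_le U D x y >].

Let leT_refl : reflexive leT.
Proof. by move=> x; apply/asboolP. Qed.

Let leT_anti : antisymmetric leT.
Proof. by move=> x y /andP[/asboolP xy /asboolP]; exact: ultra_le_anti. Qed.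

Let leT_trans : transitive leT.
Proof.
by move=> y x z /asboolP xy /asboolP yz; apply/asboolP; exact: ultra_le_trans yz.
Qed.

Let leT_total : total leT.
Proof.
by move=> x y; apply/orP; have [?|?] := ultra_le_total x y; [left|right];
  apply/asboolP.
Qed.

HB.instance Definition _ := @Order.Le_isPOrder.Build Order.default_display T
  leT leT_refl leT_anti leT_trans.
HB.instance Definition _ :=
  @Order.POrder_isTotal.Build Order.default_display T leT_total.

Lemma ultra_orderedE (x y : T) : (x <= y)%O = `[< ultra_le U D x y >].
Proof. by []. Qed.

End ultra_order.

(* Main.v *)
Require Import Defs.
From mathcomp Require Import all_boot all_order all_algebra.
From mathcomp Require Import all_classical all_reals all_analysis.
From mathcomp Require Import ring lra zify.

(** The continuum is a union of semicircles whose endpoints on the axis form the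
    Cantor set.  Two facts determine its order topology.

    First, every closed connected set containing [u] and [v] contains the whole
    order interval from [u] to [v] ([ultra_between]): a link of a fine chain
    around a point [w] off the set misses the set, and a connected set cannot
    jump over a link.  Hence, if two closed connected sets meet only at [x] and
    neither is reduced to [x], their union is an order neighbourhood of [x]
    ([nbhs_two_arcs]).  Every point other than the origin is where two
    arbitrarily short arcs of semicircles meet in this way, and the origin, an
    end of a single semicircle, is the least point of the order, as it is in the
    first link of all chains.  So the order topology is finer than the metric
    one ([continuous_order_topology]).

    Second, adjacent semicircles share an endpoint, and the two endpoints of a
    semicircle are symmetric about a rational centre.  So the points on the
    semicircles whose endpoints are [q + c] or [q - c], with [q] rational, form
    a set that contains with each point all short arcs of semicircles around
    it.  These classes ([knaster_class]) partition the continuum into sets that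
    are open in the order topology, and there are uncountably many of them, as
    each has countably many points in the Cantor set ([uncountable_cantor]).

    The classes being clopen, the space is not connected.  A countable dense set
    would meet all the classes, and a cluster point of the filter of complements
    of countable unions of classes would avoid its own class.  Finally, a linear
    order whose topology is finer than a metric topology is metrizable, by the
    diameters of order intervals ([order_metrizable]). *)

Set Implicit Arguments.
Unset Strict Implicit.
Unset Printing Implicit Defensive.

Import Order.TTheory GRing.Theory Num.Theory.
Import numFieldNormedType.Exports.

Local Open Scope classical_set_scope.
Local Open Scope ring_scope.

(** * Linear orders mapped injectively and continuously to a metric space *)

(** The distance of [x] and [y] is the diameter of the [f]-image of the order
    interval they span, measured with the metric truncated at 1 so that the
    supremum is finite.  The triangle inequality holds because the interval
    spanned by [x] and [z] is covered by those spanned by [x, y] and [y, z],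
    which share [y].  Small balls stay inside a given interval around [x], as
    getting past an endpoint [l] costs at least the truncated distance of [f x]
    and [f l]; small intervals stay inside a given ball by continuity of [f]. *)
Lemma order_metrizable (R : realType) (X : metricType R) d
    (T : orderTopologicalType d) (f : T -> X) :
  injective f -> continuous f -> metrizable R T.
Proof.
move=> injf cf.
pose rho u v : R := Num.min 1 (mdist (f u) (f v)).
have rho_ge0 u v : 0 <= rho u v by rewrite le_min ler01 mdist_ge0.
have rho_le1 u v : rho u v <= 1 by rewrite ge_min lexx.
have rhoC u v : rho u v = rho v u by rewrite /rho metric_sym.
have rhoD w u v : rho u v <= rho u w + rho w v.
  have := metric_triangle (f u) (f w) (f v); rewrite /rho.
  have := mdist_ge0 (f u) (f w); have := mdist_ge0 (f w) (f v).
  by case: (leP 1 (mdist (f u) (f v))); case: (leP 1 (mdist (f u) (f w)));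
    case: (leP 1 (mdist (f w) (f v))); lra.
have rho_eq0 u v : rho u v = 0 -> u = v.
  rewrite /rho; case: leP => [_ /eqP|_ /mdist_positivity/injf//].
  by rewrite oner_eq0.
pose hull x y := [set z : T | (Order.min x y <= z <= Order.max x y)%O].
pose spread x y := [set rho uv.1 uv.2 | uv in hull x y `*` hull x y].
have hulll x y : hull x y x by rewrite /hull /= ge_min lexx le_max lexx.
have hullC x y : hull x y = hull y x.
  by rewrite /hull /= minC maxC.
have hullr x y : hull x y y by rewrite hullC.
have hullD y x z : hull x z `<=` hull x y `|` hull y z.
  move=> w; rewrite /hull /= !ge_min !le_max.
  case: (leP w y) => [wy|/ltW yw]; last rewrite yw.
    by case/andP => /orP[|] -> _; rewrite ?orbT /=; [left|right].
  by case/andP => _ /orP[|] ->; rewrite ?orbT /=; [left|right].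
pose dist x y := sup (spread x y).
have spread_sup x y : has_sup (spread x y).
  split; first by exists (rho x x), (x, x).
  by exists 1 => _ [uv _ <-].
have rho_dist x y u v : hull x y u -> hull x y v -> rho u v <= dist x y.
  by move=> hu hv; apply: (sup_upper_bound (spread_sup x y)); exists (u, v).
have dist_le x y e : (forall u v, hull x y u -> hull x y v -> rho u v <= e) ->
    dist x y <= e.
  move=> h; apply: ge_sup; first by case: (spread_sup x y).
  by move=> _ [[u v] [/= hu hv] <-]; exact: h.
have dist_ge0 x y : 0 <= dist x y.
  by apply: le_trans (rho_ge0 x x) _; apply: rho_dist.
exists dist; split.
- move=> x; apply/eqP; rewrite eq_le dist_ge0 andbT; apply: dist_le => u v.
  rewrite /hull /= minxx maxxx => /le_anti <- /le_anti <-.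
  by rewrite /rho mdistxx ge_min lexx orbT.
- move=> x y d0; apply: rho_eq0; apply/eqP.
  by rewrite eq_le rho_ge0 andbT -d0; apply: rho_dist.
- by move=> x y; rewrite /dist /spread hullC.
- move=> y x z; apply: dist_le => u v hu hv.
  wlog hu' : u v hu hv / hull x y u.
    move=> W; have [xu|yu] := hullD y _ _ _ hu; first exact: W.
    have [xv|yv] := hullD y _ _ _ hv; first by rewrite rhoC; apply: W.
    rewrite -[leLHS]add0r; apply: lerD; first exact: dist_ge0.
    exact: rho_dist.
  have [xv|yv] := hullD y _ _ _ hv.
    by rewrite -[leLHS]addr0; apply: lerD; [exact: rho_dist|exact: dist_ge0].
  by apply: le_trans (rhoD y u v) _; apply: lerD; apply: rho_dist.
move=> x; rewrite eqEsubset; split => V.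
  rewrite itv_nbhsE => -[[lo hi] [oi]].
  rewrite itv_boundlr => /andP[xlo xhi] iV.
  have away y : y != x -> 0 < rho x y.
    by rewrite lt_def rho_ge0 andbT; apply: contra_neq => /rho_eq0.
  have [e e0 elo] : exists2 e : R, 0 < e &
      forall z, dist x z < e -> (lo <= BLeft z)%O.
    move: lo oi xlo {iV} => [[] l|[]] oi xlo; last 2 first.
    + by exists 1.
    + by move: xlo.
    + by move: oi; case: hi {xhi} => [[]?|[]].
    have lx : (l < x)%O by move: xlo; rewrite bnd_simp.
    exists (rho x l) => [|z]; first by rewrite away // lt_eqF.
    rewrite bnd_simp !ltNge; apply: contra => zl; apply: rho_dist => //.
    by rewrite /hull /= ge_min le_max zl (ltW lx) orbT.
  have [e' e'0 ehi] : exists2 e : R, 0 < e &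
      forall z, dist x z < e -> (BRight z <= hi)%O.
    move: hi oi xhi {iV} => [[] r|[]] oi xhi; last 2 first.
    + by move: xhi.
    + by exists 1.
    + have xr : (x < r)%O by move: xhi; rewrite bnd_simp.
      exists (rho x r) => [|z]; first by rewrite away // gt_eqF.
      rewrite bnd_simp !ltNge; apply: contra => rz; apply: rho_dist => //.
      by rewrite /hull /= ge_min le_max rz (ltW xr) orbT.
    by move: oi; case: lo {xlo elo} => [[]?|[]].
  exists (Num.min e e'); first by rewrite /= lt_min e0.
  move=> z /=; rewrite lt_min => /andP[ze ze']; apply: iV.
  by rewrite /= itv_boundlr elo // ehi.
move=> [e /= e0 eV].
have e3 : 0 < e / 3 by rewrite divr_gt0.
have : nbhs x (f @^-1` ball (f x) (e / 3)) by apply: cf; exact: nbhsx_ballx.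
rewrite itv_nbhsE => -[i [oi xi] ie]; exists i => //.
move=> z zi; apply: eV; apply: (@le_lt_trans _ _ (e / 3 + e / 3)); last lra.
have near u : hull x z u -> rho u x <= e / 3.
  move=> /andP[mu uM]; have /ie : [set` i] u.
    have mi : Order.min x z \in i by case: leP.
    have Mi : Order.max x z \in i by case: leP.
    case: i mi Mi {oi xi ie zi} => lo hi; rewrite /= !itv_boundlr.
    move=> /andP[lom _] /andP[_ Mhi].
    by rewrite (le_trans lom) ?(le_trans _ Mhi) // bnd_simp.
  rewrite /= ballEmdist /= => /ltW; rewrite metric_sym => h.
  by rewrite ge_min h orbT.
apply: dist_le => u v hu hv; apply: le_trans (rhoD x u v) _.
by rewrite (rhoC x v); apply: lerD; apply: near.
Qed.

(** * Connected sets are convex for ultrafilter orders *)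

Section ultrafilter.
Context {U : set_system nat}.
Hypotheses (UU : UltraFilter U) (npU : nonprincipal U).

Lemma nonprincipal_setC1 (N : nat) : U (~` [set N]).
Proof.
have [UN|//] := in_ultra_setVsetC [set N] UU.
case: (npU (x := N)).
apply: (@max_filter _ _ (principal_filter_ultra N) U (@ultra_proper _ _ UU)).
by move=> A /principal_filterP AN; apply: filterS UN => n ->.
Qed.

Lemma nonprincipal_cofinite : \oo `<=` U.
Proof.
move=> A [N _ NA]; apply: (filterS NA); elim: N {NA} => [|N IH].
  by apply: filterS filterT.
apply: filterS (filterI IH (nonprincipal_setC1 N)) => n [/= Nn] /eqP nN.
by rewrite ltn_neqAle eq_sym nN.
Qed.

End ultrafilter.

Section ultra_order_convexity.
Context {R : realType} {X : metricType R}.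
Context {U : set_system nat} {D : nat -> chain X}.
Context {UU : UltraFilter U} {npU : nonprincipal U}.
Context {cD : forall n, covers (D n)} {mD : mesh (D n) @[n --> \oo] --> 0%E}.

Local Notation T := (ultra_ordered UU npU cD mD).
Local Notation oT := (order_topology T).

Lemma mesh_link (C : chain X) (i : 'I_(chain_last C).+1) (x y : X) (e : R) :
  (mesh C < e%:E)%E -> link C i x -> link C i y -> mdist x y < e.
Proof.
move=> me ix iy; rewrite -lte_fin; apply: le_lt_trans me.
rewrite /mesh (bigD1 i) //= le_max; apply/orP; left.
by apply: ereal_sup_ubound; exists (x, y).
Qed.

(** A connected set that avoids one link of a covering chain cannot have points
    on both sides of it: the earlier and the later links have disjoint open
    unions, which would separate the set. *)
Lemma chain_separation (C : chain X) (j : 'I_(chain_last C).+1) (A : set X) :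
  covers C -> connected A -> (forall x, A x -> ~ link C j x) ->
  forall (i k : 'I_(chain_last C).+1) x y, (i < j)%N -> (j < k)%N ->
  A x -> A y -> link C i x -> link C k y -> False.
Proof.
move=> cC conA jA i k x y ij jk Ax Ay ix ky.
pose P := \bigcup_(l in [set l : 'I_(chain_last C).+1 | (l < j)%N]) link C l.
pose Q := \bigcup_(l in [set l : 'I_(chain_last C).+1 | (j < l)%N]) link C l.
have PQ z : P z -> Q z -> False.
  move=> [l /= lj lz] [l' /= jl' lz'].
  by have : (`|(l : nat) - (l' : nat)| <= 1)%N;
    [apply/(link_meet l l'); exists z | lia].
have APQ z : A z -> P z \/ Q z.
  move=> Az; have : (\bigcup_i link C i) z by rewrite cC.
  move=> [l _ lz]; have [lj|jl|/val_inj lj] := ltngtP l j.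
  - by left; exists l.
  - by right; exists l.
  - by case: (jA z Az); rewrite -lj.
have oP : open P by apply: bigcup_open => l _; exact: link_open.
have oQ : open Q by apply: bigcup_open => l _; exact: link_open.
have : A `&` P = A.
  apply: conA; first by exists x; split => //; exists i.
  - by exists P.
  - exists (~` Q); first by rewrite closedC.
    apply/seteqP; split => z [Az zP]; split => //; first by move=> /(PQ _ zP).
    by case: (APQ z Az).
by move=> AP; apply: (PQ y); [move: Ay; rewrite -AP => -[] | exists k].
Qed.

(** If [w] is off [A], then for some [n] every link of [D n] through [w] misses
    [A], since the mesh tends to 0, while [u] and [v] lie in links on either
    side of it. *)
Lemma ultra_between (A : set X) (u w v : T) :
  closed A -> connected A -> A u -> A v -> (u <= w <= v)%O -> A w.
Proof.
move=> clA conA Au Av /andP[]; rewrite !ultra_orderedE.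
move=> /asboolP uw /asboolP wv; apply: contrapT => nAw.
have : nbhs (w : X) (~` A).
  by apply: open_nbhs_nbhs; split => //; rewrite openC.
rewrite -nbhs_ballE => -[e /= e0]; rewrite ballEmdist => eA.
have me : U [set n | (mesh (D n) < e%:E)%E].
  by apply: (nonprincipal_cofinite UU npU); apply: (mD (open_ereal_lt' _)).
have UF : ProperFilter U by exact: ultra_proper.
have [n [/= men [[i [j [ij iu jw]]] [j' [k [jk jw' kv]]]]]] :=
  filter_ex (filterI me (filterI uw wv)).
have far (l : 'I_(chain_last (D n)).+1) : link (D n) l w ->
    forall x, A x -> ~ link (D n) l x.
  by move=> lw x Ax lx; apply: (eA x) => //=; apply: mesh_link men lw lx.
have jj' : (`|(j : nat) - (j' : nat)| <= 1)%N.
  by apply/link_meet; exists (w : X).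
have nij : i != j by apply/eqP => e'; apply: (far j jw u) => //; rewrite -e'.
have nj'k : j' != k by apply/eqP => e'; apply: (far j' jw' v) => //; rewrite e'.
have njk : j != k by apply/eqP => e'; apply: (far j jw v) => //; rewrite e'.
(* [k] is at least [j'], hence at least [j - 1], and differs from both [j'] and
   [j]; so it lies beyond [j]. *)
rewrite -val_eqE /= in nij; rewrite -val_eqE /= in nj'k.
rewrite -val_eqE /= in njk.
by apply: (chain_separation (cD n) conA (far j jw) _ _ Au Av iu kv); lia.
Qed.

(** Arcs to the left and to the right of [x] are order neighbourhoods: were [a]
    and [b] on the same side of [x], the one nearer to [x] would belong to
    both sets by convexity. *)
Lemma nbhs_two_arcs (A B : set X) (x a b : T) :
  closed A -> connected A -> closed B -> connected B ->
  A x -> A a -> B x -> B b -> a != x -> b != x -> A `&` B `<=` [set x] ->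
  nbhs (x : oT) (A `|` B).
Proof.
move=> clA cA clB cB Ax Aa Bx Bb ax bx ABx.
wlog xb : A B a b clA cA clB cB Ax Aa Bx Bb ax bx ABx / (x < b)%O.
  move=> W; have [xb|nxb] := boolP (x < b)%O; first exact: (W A B a b).
  have bx' : (b < x)%O by rewrite lt_neqAle bx leNgt.
  have [xa|nxa] := boolP (x < a)%O.
    by rewrite setUC; apply: (W B A b a) => //; rewrite setIC.
  have ax' : (a < x)%O by rewrite lt_neqAle ax leNgt.
  have [ab|/ltW ba] := leP a b.
    have Ab : A b by apply: (ultra_between clA cA Aa Ax); rewrite ab ltW.
    by have /= /eqP := ABx b (conj Ab Bb); rewrite (negPf bx).
  have Ba : B a by apply: (ultra_between clB cB Bb Bx); rewrite ba ltW.
  by have /= /eqP := ABx a (conj Aa Ba); rewrite (negPf ax).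
have ax' : (a < x)%O.
  rewrite ltNge; apply/negP => xa; have [ab|/ltW ba] := leP a b.
    have Ba : B a by apply: (ultra_between clB cB Bx Bb); rewrite xa.
    by have /= /eqP := ABx a (conj Aa Ba); rewrite (negPf ax).
  have Ab : A b by apply: (ultra_between clA cA Ax Aa); rewrite (ltW xb).
  by have /= /eqP := ABx b (conj Ab Bb); rewrite (negPf bx).
rewrite itv_nbhsE; exists `]a, b[%O; first by rewrite in_itv /= ax' xb.
move=> w; rewrite /= in_itv /= => /andP[/ltW aw /ltW wb].
have [wx|/ltW xw] := leP w x.
  by left; apply: (ultra_between clA cA Aa Ax); rewrite aw.
by right; apply: (ultra_between clB cB Bx Bb); rewrite xw.
Qed.

Lemma first_link_min (o : X) : (forall n, link (D n) ord0 o) ->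
  forall w : T, ((o : T) <= w)%O.
Proof.
move=> D0 w; rewrite ultra_orderedE; apply/asboolP.
apply: filterS filterT => n _ /=.
have : (\bigcup_i link (D n) i) w by rewrite cD.
by move=> [i _ iw]; exists ord0, i.
Qed.

Lemma nbhs_min_arc (A : set X) (o a : T) :
  closed A -> connected A -> A o -> A a -> a != o ->
  (forall w : T, (o <= w)%O) -> nbhs (o : oT) A.
Proof.
move=> clA cA Ao Aa ao omin; rewrite itv_nbhsE.
exists `]-oo, a[%O; first by rewrite in_itv /= lt_neqAle eq_sym ao omin.
move=> w; rewrite /= in_itv /= => /ltW wa.
by apply: (ultra_between clA cA Ao Aa); rewrite omin.
Qed.

End ultra_order_convexity.

(** * The Cantor set: symmetries and uncountability *)

Section cantor_ternary.
Context {R : realType}.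
Implicit Types a x : R.
Local Notation C := (@cantor_ternary R).

Lemma cantor_stage_itv n x : cantor_stage n x -> 0 <= x <= 1.
Proof.
elim: n x => [|n IH] x /=; first by rewrite in_itv.
by case=> -[y /IH /andP[y0 y1] <-]; apply/andP; split; lra.
Qed.

Lemma cantor_itv a : C a -> 0 <= a <= 1.
Proof. by move=> /(_ 0%N I); exact: cantor_stage_itv. Qed.

Lemma cantor_gap a : C a -> a <= 1 / 3 \/ 2 / 3 <= a.
Proof.
by move=> /(_ 1%N I) [] [y /(@cantor_stage_itv 0) /andP[y0 y1] <-];
  [left|right]; lra.
Qed.

Lemma cantor_mul3 a : C a -> a <= 1 / 3 -> C (3 * a).
Proof.
move=> Ca a3 n _; have [] := Ca n.+1 I => -[y /= Cy ya].
  by rewrite -ya mulrC divfK.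
by have /andP[y0 _] := cantor_stage_itv Cy; lra.
Qed.

Lemma cantor_mul3B2 a : C a -> 2 / 3 <= a -> C (3 * a - 2).
Proof.
move=> Ca a3 n _; have [] := Ca n.+1 I => -[y /= Cy ya].
  by have /andP[_ y1] := cantor_stage_itv Cy; lra.
by have -> : 3 * a - 2 = y by lra.
Qed.

Lemma cantor_div3 a : C a -> C (a / 3).
Proof.
move=> Ca [|n] _; last by left; exists a => //; exact: Ca.
by have /andP[a0 a1] := cantor_itv Ca; rewrite /= in_itv /=; lra.
Qed.

Lemma cantor_2Ddiv3 a : C a -> C ((2 + a) / 3).
Proof.
move=> Ca [|n] _; last by right; exists a => //; exact: Ca.
by have /andP[a0 a1] := cantor_itv Ca; rewrite /= in_itv /=; lra.
Qed.

Lemma cantor_sym a : C a -> C (1 - a).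
Proof.
move=> Ca n; elim: n a {Ca}(Ca n I) => [|n IH] a /=.
  by rewrite !in_itv /= => /andP[? ?] _; lra.
by case=> -[y Cy <-] _; [right|left]; exists (1 - y); by [exact: IH | lra].
Qed.

Lemma cantor_neq_half a : C a -> a != 1 / 2.
Proof.
by move=> /cantor_gap h; rewrite neq_lt; case: h => h; apply/orP;
  [left|right]; lra.
Qed.


Lemma div_expr3S (c : R) m : c / 3 ^+ m.+1 = c / 3 ^+ m / 3.
Proof. by rewrite exprSr invfM mulrA. Qed.

Lemma div_expr3E (c : R) m : c / 3 ^+ m = c * (1 / 3 ^+ m).
Proof. by rewrite mul1r. Qed.

Lemma div_expr3_le1 m : 1 / 3 ^+ m <= 1 :> R.
Proof. by rewrite ler_pdivrMr ?exprn_gt0 // mul1r exprn_ege1 //; lra. Qed.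

(** Tripling [a] as long as it stays in the left third must end, and the number
    of steps locates the level of the lower semicircle that starts at [a]. *)
Lemma cantor_level a : C a -> a != 0 ->
  exists2 m, 2 / 3 ^+ m.+1 <= a & a <= 1 / 3 ^+ m.
Proof.
move=> Ca a_neq0; have /andP[a_ge0 _] := cantor_itv Ca.
have a0 : 0 < a by rewrite lt_def a_neq0.
have [N aN] : exists N, 1 < 3 ^+ N * a.
  exists (Num.truncn a^-1).+1; rewrite -ltr_pdivrMr // mul1r.
  apply: lt_trans (truncnS_gt _) _.
  by rewrite -natrX ltr_nat ltn_expl.
elim: N a Ca a0 aN {a_neq0 a_ge0} => [|N IH] a Ca a0 aN.
  by have /andP[_ a1] := cantor_itv Ca; lra.
have [a3|a3] := cantor_gap Ca; last first.
  have /andP[_ a1] := cantor_itv Ca.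
  by exists 0%N; rewrite ?expr1 // expr0 divr1.
have [||m m1 m2] := IH _ (cantor_mul3 Ca a3).
- lra.
- by rewrite mulrA -exprSr.
exists m.+1.
  by rewrite div_expr3S; lra.
by rewrite div_expr3S; lra.
Qed.

(** The part of the Cantor set at level [m] is a copy of the whole, scaled by
    [1 / 3 ^+ m.+1], so it inherits the symmetry [x |-> 1 - x] as the reflection
    in the common centre of the lower semicircles at that level. *)
Lemma cantor_level_sym m a : C a -> 2 / 3 ^+ m.+1 <= a -> a <= 1 / 3 ^+ m ->
  C (5 / 3 ^+ m.+1 - a).
Proof.
elim: m a => [|m IH] a Ca am1 am2.
  have Cb := cantor_2Ddiv3 (cantor_sym (cantor_mul3B2 Ca am1)).
  rewrite (_ : _ - a = (2 + (1 - (3 * a - 2))) / 3) //.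
  by rewrite expr1; lra.
rewrite div_expr3S in am1; rewrite div_expr3S in am2.
have P := div_expr3_le1 m.
have /cantor_div3 : C (5 / 3 ^+ m.+1 - 3 * a).
  by apply: IH; [apply: cantor_mul3 => //; lra | lra | lra].
by rewrite [5 / 3 ^+ m.+2]div_expr3S mulrBl [3 * a]mulrC mulfK.
Qed.

Lemma cantor_level_neq_mid m a : C a -> 2 / 3 ^+ m.+1 <= a ->
  a <= 1 / 3 ^+ m -> a != 5 / (2 * 3 ^+ m.+1).
Proof.
elim: m a => [|m IH] a Ca am1 am2.
  have := cantor_neq_half (cantor_mul3B2 Ca am1).
  by apply: contra_neq => ->; rewrite expr1; lra.
rewrite div_expr3S in am1; rewrite div_expr3S in am2.
have P := div_expr3_le1 m.
have : 3 * a != 5 / (2 * 3 ^+ m.+1).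
  by apply: IH; [apply: cantor_mul3 => //; lra | lra | lra].
apply: contra_neq => ->.
have -> : 5 / (2 * 3 ^+ m.+2) = 5 / (2 * 3 ^+ m.+1) / 3 :> R.
  by rewrite exprSr mulrA invfM mulrA.
by rewrite mulrC divfK.
Qed.

Definition tail (b : nat -> bool) : nat -> bool := fun n => b n.+1.

(** The sum of the [2 * b i / 3 ^+ i.+1] over [i < n], in Horner form, which
    matches the self-similarity of the Cantor set. *)
Fixpoint cantor_sum (n : nat) (b : nat -> bool) : R :=
  if n is m.+1 then (2 * (b 0%N)%:R + cantor_sum m (tail b)) / 3 else 0.

Lemma cantor_sum_itv n b : 0 <= cantor_sum n b <= 1.
Proof.
elim: n b => [|n IH] b /=; first by rewrite lexx ler01.
have /andP[h0 h1] := IH (tail b).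
by case: (b 0%N) => /=; apply/andP; split; lra.
Qed.

Lemma cantor_sum_nondecreasing b : nondecreasing_seq (cantor_sum ^~ b).
Proof.
apply/nondecreasing_seqP => n; elim: n b => [|n IH] b.
  by have /andP[] := cantor_sum_itv 1 b.
by have := IH (tail b); rewrite /=; lra.
Qed.

Definition cantor_point (b : nat -> bool) : R := limn (cantor_sum ^~ b).

Lemma cvg_cantor_sum b : cantor_sum ^~ b @ \oo --> cantor_point b.
Proof.
apply: nondecreasing_is_cvgn; first exact: cantor_sum_nondecreasing.
by exists 1 => _ [n _ <-]; have /andP[] := cantor_sum_itv n b.
Qed.

Lemma cantor_point_itv b : 0 <= cantor_point b <= 1.
Proof.
apply/andP; split.
  apply: limr_ge; first exact: (@cvg_cantor_sum b).
  by near=> n; have /andP[] := cantor_sum_itv n b.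
apply: limr_le; first exact: (@cvg_cantor_sum b).
by near=> n; have /andP[] := cantor_sum_itv n b.
Unshelve. all: by end_near. Qed.

Lemma cantor_pointE b :
  cantor_point b = (2 * (b 0%N)%:R + cantor_point (tail b)) / 3.
Proof.
have h : (fun n => cantor_sum n.+1 b) @ \oo --> cantor_point b.
  by rewrite (cvg_shiftS (cantor_sum ^~ b)); exact: cvg_cantor_sum.
apply: (cvg_unique _ h) => //=.
by apply: cvgMl; apply: cvgD; [exact: cvg_cst | exact: cvg_cantor_sum].
Qed.

Lemma cantor_pointP b : C (cantor_point b).
Proof.
move=> n _; elim: n b => [|n IH] b.
  by rewrite /= in_itv; exact: cantor_point_itv.
rewrite cantor_pointE; case: (b 0%N); [right|left];
  exists (cantor_point (tail b)) => //.
  by rewrite mulr1.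
by rewrite mulr0 add0r.
Qed.

Lemma cantor_point_inj : injective cantor_point.
Proof.
move=> b c bc; apply/funext => n; elim: n b c bc => [|n IH] b c;
  rewrite (cantor_pointE b) (cantor_pointE c);
  have /andP[b0 b1] := cantor_point_itv (tail b);
  have /andP[c0 c1] := cantor_point_itv (tail c) => bc.
  by move: bc; case: (b 0%N); case: (c 0%N) => //=; lra.
apply: (IH (tail b) (tail c)); move: bc.
by case: (b 0%N); case: (c 0%N) => /= bc; lra.
Qed.

(** Cantor's diagonal argument on the binary sequences that [cantor_point]
    embeds in the set. *)
Lemma uncountable_cantor : ~ countable C.
Proof.
move=> /countable_injP[f injf].
have gK b c : f (cantor_point b) = f (cantor_point c) -> b = c.
  move=> /injf h; apply/cantor_point_inj/h; apply/mem_set;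
    exact: cantor_pointP.
pose diag n := `[< exists b, f (cantor_point b) = n /\ b n = false >].
set n := f (cantor_point diag).
have [dn|dn] := boolP (diag n).
  have /asboolP[b [/gK bd bn]] := dn.
  by move: dn; rewrite -bd bn.
by case/negP: (dn); apply/asboolP; exists diag; split => //; exact: negbTE.
Qed.

End cantor_ternary.

Lemma ler_norm_sqr (R : realDomainType) (x h : R) : 0 <= h ->
  (`|x| <= h) = (x ^+ 2 <= h ^+ 2).
Proof. by move=> h0; rewrite -real_normK ?num_real// ler_sqr ?nnegrE. Qed.

Lemma ltr_norm_sqr (R : realDomainType) (x h : R) : 0 <= h ->
  (`|x| < h) = (x ^+ 2 < h ^+ 2).
Proof. by move=> h0; rewrite -real_normK ?num_real// ltr_sqr ?nnegrE. Qed.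

(** * Points related by rational translations and reflections *)

Section rational_equivalence.
Context {R : realType}.
Implicit Types a b c : R.

(** The endpoints of a semicircle of the continuum are symmetric about its
    rational centre, so the Cantor points that one path of semicircles runs
    through are all equivalent.  The relation is coarser than lying on the same
    path, but its classes are visibly countable. *)
Definition rat_equiv a b : Prop :=
  exists q : rat, b = a + ratr q \/ b = - a + ratr q.

Lemma rat_equiv_refl a : rat_equiv a a.
Proof. by exists 0; left; rewrite rmorph0 addr0. Qed.

Lemma rat_equiv_sym a b : rat_equiv a b -> rat_equiv b a.
Proof.
move=> [q [->|->]]; first by exists (- q); left; rewrite rmorphN; lra.
by exists q; right; lra.
Qed.

Lemma rat_equiv_trans b a c : rat_equiv a b -> rat_equiv b c -> rat_equiv a c.
Proof.
move=> [p [->|->]] [q [->|->]].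
- by exists (p + q); left; rewrite rmorphD; lra.
- by exists (q - p); right; rewrite rmorphB; lra.
- by exists (p + q); right; rewrite rmorphD; lra.
- by exists (q - p); left; rewrite rmorphB; lra.
Qed.

Lemma rat_equiv_reflect a q : rat_equiv a (2 * ratr q - a).
Proof. by exists (q + q); right; rewrite rmorphD; lra. Qed.

Lemma countable_rat_equiv a : countable (rat_equiv a).
Proof.
have -> : rat_equiv a = \bigcup_(q in [set: rat]) [set a + ratr q]
    `|` \bigcup_(q in [set: rat]) [set - a + ratr q].
  apply/seteqP; split => b; first by case=> q [->|->]; [left|right]; exists q.
  by case=> -[q _ ->]; exists q; [left|right].
rewrite -bigcup2E; apply: bigcup_countable; first exact: countableP.
move=> [|[|n]] _ /=; last exact: countable0.
  by apply: bigcup_countable => // q _; exact: countable1.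
by apply: bigcup_countable => // q _; exact: countable1.
Qed.

End rational_equivalence.

(** * The semicircles of the Knaster continuum *)

Section knaster_semicircles.
Context {R : realType}.
Implicit Types (s m a b c t : R) (p : plane R).
Local Notation C := (@cantor_ternary R).
Local Notation K := (knaster R).

(** The upper ([s = 1]) or lower ([s = -1]) semicircle with centre [(m, 0)]
    through [(a, 0)]. *)
Definition semicircle s m a : set (plane R) :=
  [set p | (p.1 - m) ^+ 2 + p.2 ^+ 2 = (a - m) ^+ 2 /\ 0 <= s * p.2].

Definition knaster_semicircle s m a : Prop := C a /\
  (s = 1 /\ m = 1 / 2 \/
   s = -1 /\ exists k, m = 5 / (2 * 3 ^+ k.+1) /\
     2 / 3 ^+ k.+1 <= a <= 1 / 3 ^+ k).

Lemma eq_mdist_axis m a p :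
  mdist ((m, 0) : plane R) p = mdist ((m, 0) : plane R) (a, 0) <->
  (p.1 - m) ^+ 2 + p.2 ^+ 2 = (a - m) ^+ 2.
Proof.
have E q : mdist ((m, 0) : plane R) q = Num.sqrt ((q.1 - m) ^+ 2 + q.2 ^+ 2).
  rewrite -[LHS]/(eucl_dist _ _) /eucl_dist /= sub0r sqrrN.
  by rewrite -(sqrrN (m - _)) opprB.
rewrite !E /= expr0n addr0; split; last by move=> ->.
move=> /(congr1 (fun x => x ^+ 2)).
by rewrite !sqr_sqrtr ?addr_ge0 ?sqr_ge0.
Qed.

Lemma knaster_setP p : knaster_set p <->
  exists s m a, knaster_semicircle s m a /\ semicircle s m a p.
Proof.
split.
  case=> [[a Ca [/eq_mdist_axis pa p2]]|
          [[|k] //= _ [a [Ca ak] [/eq_mdist_axis pa p2]]]].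
    by exists 1, (1 / 2), a; do ?split => //; [left | rewrite mul1r].
  exists (-1), (5 / (2 * 3 ^+ k.+1)), a; do ?split => //; last by lra.
  by right; split => //; exists k; move: ak; rewrite /= in_itv.
move=> [s [m [a [[Ca [[-> ->]|[-> [k [-> ak]]]]] [/eq_mdist_axis pa p2]]]]].
  by left; exists a => //; split => //; move: p2; rewrite mul1r.
right; exists k.+1 => //; exists a; first by split; rewrite //= in_itv.
by split => //=; lra.
Qed.

Lemma knaster_semicircle_neq s m a : knaster_semicircle s m a -> a != m.
Proof.
move=> [Ca [[_ ->]|[_ [k [-> /andP[ak1 ak2]]]]]]; first exact: cantor_neq_half.
exact: cantor_level_neq_mid.
Qed.

Lemma knaster_semicircle_reflect s m a :
  knaster_semicircle s m a -> knaster_semicircle s m (2 * m - a).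
Proof.
move=> [Ca [[-> ->]|[-> [k [-> /andP[ak1 ak2]]]]]].
  split; last by left.
  rewrite (_ : 2 * (1 / 2) - a = 1 - a); [exact: cantor_sym | lra].
have -> : 2 * (5 / (2 * 3 ^+ k.+1)) = 5 / 3 ^+ k.+1 :> R.
  by rewrite invfM; lra.
split; first exact: cantor_level_sym.
right; split => //; exists k; split => //.
by move: ak1 ak2; rewrite !div_expr3S (div_expr3E 5) (div_expr3E 2); lra.
Qed.

Lemma knaster_semicircle_rat s m a :
  knaster_semicircle s m a -> exists q : rat, m = ratr q.
Proof.
move=> [_ [[_ ->]|[_ [k [-> _]]]]].
  by exists (1 / 2); rewrite fmorph_div rmorph1 rmorph_nat.
exists (5 / (2 * 3 ^+ k.+1)).
by rewrite fmorph_div rmorphM rmorphXn /= !rmorph_nat.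
Qed.

Lemma semicircle_axis_refl s m a : semicircle s m a (a, 0).
Proof. by split; rewrite /= ?expr0n ?addr0 ?mulr0. Qed.

Lemma semicircle_axis s m a p : semicircle s m a p -> p.2 = 0 ->
  p.1 = a \/ p.1 = 2 * m - a.
Proof.
move=> [+ _] p2; rewrite p2 expr0n addr0 => /eqP; rewrite eqf_sqr.
by case/orP => /eqP h; [left|right]; lra.
Qed.

Lemma knaster_semicircle_axis s m a p :
  knaster_semicircle s m a -> semicircle s m a p -> p.2 = 0 ->
  knaster_semicircle s m p.1 /\ rat_equiv a p.1.
Proof.
move=> h hp /(semicircle_axis hp)[->|->].
  by split => //; exact: rat_equiv_refl.
split; first exact: knaster_semicircle_reflect.
have [q ->] := knaster_semicircle_rat h; exact: rat_equiv_reflect.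
Qed.

(** The abscissae on a lower semicircle are at most as far from its centre as
    [a], and both ends of the interval of level [k] are [1 / (6 * 3 ^+ k)] away
    from the centre. *)
Lemma lower_semicircle_level a k p : 2 / 3 ^+ k.+1 <= a <= 1 / 3 ^+ k ->
  semicircle (-1) (5 / (2 * 3 ^+ k.+1)) a p ->
  2 / 3 ^+ k.+1 <= p.1 <= 1 / 3 ^+ k.
Proof.
have -> : 5 / (2 * 3 ^+ k.+1) = 5 / 6 * (1 / 3 ^+ k) :> R.
  by rewrite exprSr mulrA [2 * _]mulrC -mulrA; field;
    rewrite lt0r_neq0 ?exprn_gt0.
rewrite div_expr3S (div_expr3E 2); set h := 1 / 3 ^+ k.
have h0 : 0 < h by rewrite divr_gt0 ?exprn_gt0.
move=> /andP[a1 a2] [pa _].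
have q2 : (p.1 - 5 / 6 * h) ^+ 2 <= (1 / 6 * h) ^+ 2.
  have := sqr_ge0 p.2; have : (a - 5 / 6 * h) ^+ 2 <= (1 / 6 * h) ^+ 2.
    by rewrite -ler_norm_sqr ?ler_norml; lra.
  lra.
have : `|p.1 - 5 / 6 * h| <= 1 / 6 * h by rewrite ler_norm_sqr //; lra.
by rewrite ler_norml; lra.
Qed.

End knaster_semicircles.

Section knaster_paths.
Context {R : realType}.
Implicit Types (s m a b c t : R) (p : plane R).
Local Notation K := (knaster R).

(** Semicircles of the continuum meet off the axis only if they have the same
    centre, because the levels of the lower ones occupy disjoint intervals; on
    the axis they meet at a common endpoint. *)
Lemma knaster_semicircle_meet s m a s' m' a' p :
  knaster_semicircle s m a -> semicircle s m a p ->
  knaster_semicircle s' m' a' -> semicircle s' m' a' p -> rat_equiv a a'.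
Proof.
move=> h hp h' hp'; have [p2|p2] := eqVneq p.2 0.
  have [_ ap] := knaster_semicircle_axis h hp p2.
  have [_ /rat_equiv_sym] := knaster_semicircle_axis h' hp' p2.
  exact: rat_equiv_trans ap.
suff mm' : m = m'.
  have [q mq] := knaster_semicircle_rat h.
  have /eqP : (a' - m) ^+ 2 = (a - m) ^+ 2.
    by case: hp hp' => <- _ [+ _]; rewrite mm'.
  rewrite eqf_sqr => /orP[] /eqP e.
    have -> : a' = a by lra.
    exact: rat_equiv_refl.
  have -> : a' = 2 * ratr q - a by lra.
  exact: rat_equiv_reflect.
have ss' : s = s'.
  case: hp hp' => _ sp [_ s'p].
  move: sp s'p; case: h h' => _ [[-> _]|[-> _]] [_ [[-> _]|[-> _]]] // sp s'p;
    case/eqP: p2; lra.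
move: ss' hp hp'; case: h h' => _ [[-> ->]|[-> [k [-> ak]]]];
  case=> _ [[-> ->]|[-> [k' [-> ak']]]] //; try lra.
move=> _ /(lower_semicircle_level ak)/andP[k1 k2].
move=> /(lower_semicircle_level ak')/andP[k'1 k'2].
have decr i j : (i < j)%N -> 1 / 3 ^+ j < 2 / 3 ^+ i.+1 :> R.
  move=> ij; have : 1 / 3 ^+ j <= 1 / 3 ^+ i.+1 :> R.
    by rewrite !div1r lef_pV2 ?posrE ?exprn_gt0 // ler_eXn2l //; lra.
  have : 0 < 1 / 3 ^+ i.+1 :> R by rewrite divr_gt0 ?exprn_gt0.
  by rewrite (div_expr3E 2); lra.
by have [/decr|/decr|->//] := ltngtP k k'; lra.
Qed.

Lemma dist_plane_le p q : mdist p q <= `|p.1 - q.1| + `|p.2 - q.2|.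
Proof.
rewrite -[leLHS]/(eucl_dist p q) /eucl_dist.
rewrite -[leRHS]ger0_norm ?addr_ge0 // -sqrtr_sqr ler_sqrt ?sqr_ge0 //.
by rewrite [leRHS]sqrrD !real_normK ?num_real // lerD2r lerDl mulrn_wge0.
Qed.

(** * Small arcs of the semicircles *)

Section path.
Variables (s m a : R).
Hypothesis h : knaster_semicircle s m a.

Let r : R := `|a - m|.

(** Clamping the abscissa to the semicircle makes its parametrization a total
    continuous function on the line. *)
Let clamp t : R := Num.max (m - r) (Num.min (m + r) t).

Let pathp t : plane R :=
  (clamp t, s * Num.sqrt ((a - m) ^+ 2 - (clamp t - m) ^+ 2)).

Let r_ge0 : 0 <= r. Proof. exact: normr_ge0. Qed.

Let clampE t : m - r <= t <= m + r -> clamp t = t.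
Proof.
by move=> /andP[h1 h2]; rewrite /clamp min_r // max_r.
Qed.

Let clamp_itv t : (clamp t - m) ^+ 2 <= (a - m) ^+ 2.
Proof.
rewrite -[leRHS]real_normK ?num_real// -ler_norm_sqr // ler_norml -/r.
rewrite /clamp; apply/andP; split.
  by rewrite lerBrDl le_max lexx.
by rewrite lerBlDl ge_max ge_min lexx andbT; have := r_ge0; lra.
Qed.

Let s2 : s ^+ 2 = 1.
Proof. by case: h => _ [[-> _]|[-> _]]; rewrite ?sqrrN expr1n. Qed.

Lemma semicircle_pathp t : semicircle s m a (pathp t).
Proof.
split; rewrite /pathp /=.
  by rewrite exprMn s2 mul1r sqr_sqrtr ?subr_ge0 ?clamp_itv // addrC subrK.
by rewrite mulrA -expr2 s2 mul1r sqrtr_ge0.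
Qed.

Lemma knaster_pathp t : pathp t \in @knaster_set R.
Proof.
by apply/mem_set/knaster_setP; exists s, m, a; split => //;
  exact: semicircle_pathp.
Qed.

Definition knaster_path t : K := exist _ (pathp t) (knaster_pathp t).

Let clamp_continuous : continuous clamp.
Proof.
apply: (@max_fun_continuous _ R R (cst (m - r)) (Num.min (m + r))).
  exact: cst_continuous.
apply: (@min_fun_continuous _ R R (cst (m + r)) id).
  exact: cst_continuous.
by move=> t; exact: cvg_id.
Qed.

Lemma continuous_knaster_path : continuous knaster_path.
Proof.
move=> t; apply/cvg_ballP => e e0.
have c1 : clamp u @[u --> t] --> clamp t by exact: clamp_continuous.
have c2 : (pathp u).2 @[u --> t] --> (pathp t).2.
  rewrite /pathp /=; apply: cvgM; first exact: cvg_cst.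
  apply: (@continuous_cvg _ _ _ _ _ _ (@Num.sqrt R)).
    exact: sqrt_continuous.
  apply: cvgB; first exact: cvg_cst.
  by apply: cvgM; apply: cvgB => //; exact: cvg_cst.
near=> u; rewrite ballEmdist /=.
apply: le_lt_trans (dist_plane_le (pathp t) (pathp u)) _.
rewrite [e]splitr; apply: ltrD; near: u.
  by move/cvgrPdist_lt: c1; apply; rewrite divr_gt0.
by move/cvgrPdist_lt: c2; apply; rewrite divr_gt0.
Unshelve. all: by end_near. Qed.

Lemma knaster_path_fst t : `|t - m| <= `|a - m| ->
  (set_val (knaster_path t)).1 = t.
Proof. by rewrite ler_norml => ht; apply: clampE; rewrite /r; lra. Qed.

Lemma knaster_pathK (x : K) : semicircle s m a (set_val x) ->
  knaster_path (set_val x).1 = x.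
Proof.
move=> [px sx]; apply: val_inj; rewrite /= /pathp clampE; last first.
  suff : `|(set_val x).1 - m| <= r by rewrite ler_norml; lra.
  by rewrite ler_norm_sqr // real_normK ?num_real // -px lerDl sqr_ge0.
rewrite -px addrC addKr sqrtr_sqr.
have -> : `|(set_val x).2| = s * (set_val x).2.
  have s1 : `|s| = 1 by case: h => _ [[-> _]|[-> _]]; rewrite ?normrN normr1.
  by rewrite -[RHS]ger0_norm // normrM s1 mul1r.
by rewrite mulrA -expr2 s2 mul1r -surjective_pairing.
Qed.

End path.

Lemma small_arc (X : metricType R) (f : R -> X) t0 (W : set X) :
  continuous f -> nbhs (f t0) W -> exists2 d : R, 0 < d &
    forall u v, t0 - d <= u -> v <= t0 + d ->
      [/\ closed (f @` `[u, v]), connected (f @` `[u, v]) &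
          f @` `[u, v] `<=` W].
Proof.
move=> cf /cf; rewrite /= -nbhs_ballE => -[e /= e0 eW].
exists (e / 2); first by rewrite divr_gt0.
move=> u v tu vt; have cfw (A : set R) : {within A, continuous f}.
  exact: continuous_subspaceT.
split.
- apply: compact_closed; first exact: metric_hausdorff.
  by apply: continuous_compact; [exact: cfw | exact: segment_compact].
- apply: connected_continuous_connected; last exact: cfw.
  exact: segment_connected.
move=> _ [t /= + <-]; rewrite in_itv /= => /andP[ut tv]; apply: eW.
by rewrite /ball /= ltr_norml; lra.
Qed.

(** A one-sided segment at [b] that runs towards [m], hence avoids the mirror
    image of [b] in [m].  The point [c] only witnesses that it is more than
    [b]. *)
Lemma segment_towards b m d : b != m -> 0 < d -> exists u v c,
  [/\ b - d <= u <= b, b <= v <= b + d, u <= c <= v, c != b &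
   forall t, u <= t <= v -> `|t - m| <= `|b - m| /\ (t = 2 * m - b -> t = b)].
Proof.
move=> bm d0; pose e := Num.min d `|b - m|.
have e0 : 0 < e by rewrite lt_min d0 normr_gt0 subr_eq0.
have ed : e <= d by rewrite ge_min lexx.
have em : e <= `|b - m| by rewrite ge_min lexx orbT.
have [{}bm|bm'] := ltP b m.
  have bmE : `|b - m| = m - b by rewrite ltr0_norm; lra.
  exists b, (b + e), (b + e); split; [lra|lra|lra|by rewrite gt_eqF; lra|].
  move=> t ht; rewrite ler_norml bmE; split; lra.
have {}bm : m < b by rewrite lt_neqAle eq_sym bm.
have bmE : `|b - m| = b - m by rewrite gtr0_norm; lra.
exists (b - e), b, (b - e); split; [lra|lra|lra|by rewrite lt_eqF; lra|].
move=> t ht; rewrite ler_norml bmE; split; lra.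
Qed.

(** At an endpoint of a semicircle, a short arc going inwards meets the axis
    only there; so the arcs of an upper and of a lower semicircle with that
    common endpoint will have nothing else in common. *)
Lemma semicircle_end_arc s m b (x : K) (W : set K) :
  knaster_semicircle s m b -> set_val x = (b, 0) -> nbhs x W ->
  exists A : set K, [/\ closed A, connected A, A x, exists2 y, A y & y != x &
    forall y, A y -> [/\ W y, semicircle s m b (set_val y) &
      (set_val y).2 = 0 -> y = x]].
Proof.
move=> h xb Wx; pose f := knaster_path h.
have hb : semicircle s m b (set_val x).
  by rewrite xb; exact: semicircle_axis_refl.
have fb : f b = x by have := knaster_pathK h hb; rewrite xb.
have cf : continuous f by exact: continuous_knaster_path.
rewrite -fb in Wx; have [d d0 dW] := small_arc cf Wx.
have [u [v [c [ub bv cuv cb uvb]]]] :=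
  segment_towards (knaster_semicircle_neq h) d0.
have uv : [/\ b - d <= u, v <= b + d & u <= b <= v].
  by case/andP: ub => -> ->; case/andP: bv => -> ->.
have xb1 : (set_val x).1 = b by rewrite xb.
move: uv => [bdu vbd uv]; have [clA cA AW] := dW u v bdu vbd.
exists (f @` `[u, v]); split => //.
- by exists b => //; rewrite /= in_itv.
- exists (f c); first by exists c => //; rewrite /= in_itv.
  apply: contra_neq cb => /(congr1 (fun z : K => (set_val z).1)).
  by rewrite knaster_path_fst ?xb1 //; have [] := uvb _ cuv.
move=> y Ay; split; first exact: AW.
  by case: Ay => t _ <-; exact: semicircle_pathp.
case: Ay => t /= + <-; rewrite in_itv /= => /uvb[tm tb] t2.
have := semicircle_axis (semicircle_pathp h t) t2.
rewrite -[X in X = _ \/ _]/(set_val (f t)).1 knaster_path_fst //.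
by case=> [->|/tb ->].
Qed.

Lemma semicircle_interior_arcs s m a (x : K) (W : set K) :
  knaster_semicircle s m a -> semicircle s m a (set_val x) ->
  (set_val x).2 != 0 -> nbhs x W ->
  exists A B : set K, [/\ closed A /\ connected A, closed B /\ connected B,
    A x /\ (exists2 y, A y & y != x), B x /\ (exists2 y, B y & y != x) &
    A `&` B `<=` [set x] /\
    forall y, (A `|` B) y -> W y /\ semicircle s m a (set_val y)].
Proof.
move=> h hx x2; pose f := knaster_path h; set b := (set_val x).1.
have fb : f b = x by exact: knaster_pathK.
have cf : continuous f by exact: continuous_knaster_path.
have bm : `|b - m| < `|a - m|.
  rewrite ltr_norm_sqr // real_normK ?num_real //; case: hx => <- _.
  by rewrite ltrDl exprn_even_gt0.
rewrite -{1}fb => /(small_arc cf)[d d0 dW].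
pose e := Num.min d (`|a - m| - `|b - m|).
have e0 : 0 < e by rewrite lt_min d0 subr_gt0.
have ed : e <= d by rewrite ge_min lexx.
have em : e <= `|a - m| - `|b - m| by rewrite ge_min lexx orbT.
have inr t : b - e <= t <= b + e -> `|t - m| <= `|a - m|.
  move=> ht; have : `|t - b| <= e by rewrite ler_norml; lra.
  by have := ler_normD (t - b) (b - m); rewrite subrKA; lra.
have fst t : b - e <= t <= b + e -> (set_val (f t)).1 = t.
  by move=> /inr; exact: knaster_path_fst.
have fneq t : b - e <= t <= b + e -> t != b -> f t != x.
  move=> /fst ft; apply: contra_neq => ftx.
  by rewrite -ft ftx.
have [||clA cA AW] := dW (b - e) b; [lra|lra|].
have [||clB cB BW] := dW b (b + e); [lra|lra|].
exists (f @` `[b - e, b]), (f @` `[b, b + e]); split => //.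
- split; first by exists b => //; rewrite /= in_itv /=; lra.
  exists (f (b - e)); first by exists (b - e) => //; rewrite /= in_itv /=; lra.
  by apply: fneq; [lra | rewrite lt_eqF //; lra].
- split; first by exists b => //; rewrite /= in_itv /=; lra.
  exists (f (b + e)); first by exists (b + e) => //; rewrite /= in_itv /=; lra.
  by apply: fneq; [lra | rewrite gt_eqF //; lra].
split.
  move=> _ [[t + <-] [t' + tt']]; rewrite /= !in_itv /= => ht ht'.
  have bt : b <= t.
    by rewrite -(fst t) -?tt' ?fst; lra.
  by rewrite -fb; congr f; lra.
move=> y Ay; split; first by case: Ay => [/AW|/BW].
by case: Ay => -[t _ <-]; exact: semicircle_pathp.
Qed.

End knaster_paths.

(** * Open classes for the ultrafilter order *)

Section knaster_classes.
Context {R : realType}.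
Implicit Types (s m a b c t : R).
Local Notation K := (knaster R).

(** Closed under passing to an adjacent semicircle, but small enough to meet the
    Cantor set in countably many points only. *)
Definition knaster_class c : set K := [set x | exists s m a,
  [/\ knaster_semicircle s m a, rat_equiv c a & semicircle s m a (set_val x)]].

Lemma knaster_class_cover (x : K) :
  exists2 c, cantor_ternary c & knaster_class c x.
Proof.
have /knaster_setP[s [m [a [h hx]]]] := set_mem (valP x).
by exists a; [case: h | exists s, m, a; split => //; exact: rat_equiv_refl].
Qed.

Lemma knaster_class_rat_equiv c c' (x : K) :
  knaster_class c x -> knaster_class c' x -> rat_equiv c c'.
Proof.
move=> [s [m [a [h ca hx]]]] [s' [m' [a' [h' ca' hx']]]].
apply: (rat_equiv_trans ca); apply: rat_equiv_trans (rat_equiv_sym ca').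
exact: knaster_semicircle_meet h hx h' hx'.
Qed.

Lemma rat_equiv_knaster_class c c' :
  rat_equiv c c' -> knaster_class c `<=` knaster_class c'.
Proof.
move=> cc' x [s [m [a [h ca hx]]]]; exists s, m, a; split => //.
exact: rat_equiv_trans (rat_equiv_sym cc') ca.
Qed.

Lemma semicircle_class c s m a (x : K) : knaster_semicircle s m a ->
  rat_equiv c a -> semicircle s m a (set_val x) -> knaster_class c x.
Proof. by move=> h ca hx; exists s, m, a. Qed.

Lemma upper_knaster_semicircle c :
  cantor_ternary c -> knaster_semicircle 1 (1 / 2) c.
Proof. by split => //; left. Qed.

Lemma knaster_class_axis c : cantor_ternary c ->
  exists2 x : K, set_val x = (c, 0) & knaster_class c x.
Proof.
move=> Cc; have h := upper_knaster_semicircle Cc.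
have Kc : ((c, 0) : plane R) \in @knaster_set R.
  by apply/mem_set/knaster_setP; exists 1, (1 / 2), c; split => //;
    exact: semicircle_axis_refl.
exists (exist _ (c, 0) Kc : K) => //; apply: semicircle_class h _ _.
  exact: rat_equiv_refl.
exact: semicircle_axis_refl.
Qed.

Section order.
Context {U : set_system nat} {UU : UltraFilter U} {npU : nonprincipal U}.
Context {D : nat -> chain K} {cD : forall n, covers (D n)}.
Context {mD : mesh (D n) @[n --> \oo] --> 0%E}.
Hypothesis D0 : forall n, link (D n) ord0 (knaster_origin R).
Local Notation oT := (order_topology (ultra_ordered UU npU cD mD)).

(** Off the axis, [x] cuts its semicircle into two arcs; at a nonzero Cantor
    point, an upper and a lower semicircle end.  In both cases two small
    continua of the class meet just at [x].  Only the upper semicircle ends at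
    the origin, but the origin is the least element of the order. *)
Lemma nbhs_knaster_class c (x : K) (W : set K) :
  knaster_class c x -> nbhs x W -> nbhs (x : oT) (W `&` knaster_class c).
Proof.
move=> [s [m [a [h ca hx]]]] Wx.
have [x2|x2] := eqVneq (set_val x).2 0; last first.
  have [A [B [[clA cA] [clB cB] [Ax [y Ay yx]] [Bx [z Bz zx]] [AB ABW]]]] :=
    semicircle_interior_arcs h hx x2 Wx.
  have : nbhs (x : oT) (A `|` B).
    exact: nbhs_two_arcs clA cA clB cB Ax Ay Bx Bz yx zx AB.
  apply: filterS => w /ABW[Ww hw]; split => //; exact: semicircle_class h ca hw.
have [{}h ax] := knaster_semicircle_axis h hx x2.
set b := (set_val x).1 in h ax.
have cb : rat_equiv c b := rat_equiv_trans ca ax.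
have xb : set_val x = (b, 0) by rewrite [LHS]surjective_pairing x2.
have Cb : cantor_ternary b by case: h.
have upper := upper_knaster_semicircle Cb.
have [A [clA cA Ax [y Ay yx] AW]] := semicircle_end_arc upper xb Wx.
have AWc w : A w -> (W `&` knaster_class c) w.
  by move=> /AW[Ww hw _]; split => //; exact: semicircle_class upper cb hw.
have [b0|b0] := eqVneq b 0.
  have xo : x = knaster_origin R.
    by apply: val_inj; rewrite -[LHS]/(set_val x) xb b0.
  have : nbhs (x : oT) A; last exact: filterS.
  apply: nbhs_min_arc clA cA Ax Ay yx _; rewrite xo.
  exact: first_link_min D0.
have [k bk1 bk2] := cantor_level Cb b0.
have lower : knaster_semicircle (-1) (5 / (2 * 3 ^+ k.+1)) b.
  by split => //; right; split => //; exists k; rewrite bk1 bk2.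
have [B [clB cB Bx [z Bz zx] BW]] := semicircle_end_arc lower xb Wx.
have AB : A `&` B `<=` [set x].
  move=> w [/AW[_ [_ w1] wx] /BW[_ [_ w2] _]]; apply: wx; lra.
have : nbhs (x : oT) (A `|` B).
  exact: nbhs_two_arcs clA cA clB cB Ax Ay Bx Bz yx zx AB.
apply: filterS => w [/AWc//|/BW[Ww hw _]]; split => //.
exact: semicircle_class lower cb hw.
Qed.

Lemma continuous_order_topology : continuous (fun x : oT => x : K).
Proof.
move=> x W Wx; have [c _ cx] := knaster_class_cover x.
by apply: filterS (nbhs_knaster_class cx Wx) => w [].
Qed.

Lemma open_knaster_class c : open (knaster_class c : set oT).
Proof.
rewrite openE => x cx.
have : nbhs (x : oT) (setT `&` knaster_class c).
  by apply: nbhs_knaster_class cx _; exact: filterT.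
by apply: filterS => w [].
Qed.

Lemma closed_knaster_class c : closed (knaster_class c : set oT).
Proof.
rewrite -openC openE => x ncx; have [c' _ c'x] := knaster_class_cover x.
have : nbhs (x : oT) (knaster_class c').
  by apply: open_nbhs_nbhs; split => //; exact: open_knaster_class.
apply: filterS => w c'w cw; apply: ncx.
have cc' : rat_equiv c' c := knaster_class_rat_equiv c'w cw.
exact: (rat_equiv_knaster_class cc' c'x).
Qed.

Lemma uncountable_knaster_classes (A : set R) : countable A ->
  ~ (forall a, cantor_ternary a -> exists2 c, A c & rat_equiv c a).
Proof.
move=> cA AC; apply: (@uncountable_cantor R).
have : countable (\bigcup_(c in A) rat_equiv c).
  by apply: bigcup_countable => // c _; exact: countable_rat_equiv.
apply: sub_countable; apply: subset_card_le => a /AC[c Ac ca].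
by exists c.
Qed.

Lemma not_connected_knaster_order : ~ connected [set: oT].
Proof.
move=> conn; have [x _ x0] := knaster_class_axis (@cantor_ternary0 R).
have E : knaster_class 0 = [set: oT].
  apply: conn; first by exists x.
  - by exists (knaster_class 0); [exact: open_knaster_class | rewrite setTI].
  - by exists (knaster_class 0); [exact: closed_knaster_class | rewrite setTI].
apply: (@uncountable_knaster_classes [set 0]); first exact: countable1.
move=> a Ca; exists 0 => //; have [y _ ay] := knaster_class_axis Ca.
by apply: knaster_class_rat_equiv ay; rewrite E.
Qed.

(** The complements of countable unions of classes generate a filter without
    cluster points. *)
Lemma not_compact_knaster_order : ~ compact [set: oT].
Proof.
move=> comp.
pose avoid (A : set R) : set oT := ~` \bigcup_(c in A) knaster_class c.
have avoid_proper :
    ProperFilter (filter_from [set A : set R | countable A] avoid).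
  apply: filter_from_proper; first apply: filter_from_filter.
  - by exists set0; exact: countable0.
  - move=> A B cA cB; exists (A `|` B).
      rewrite /= -bigcup2E; apply: bigcup_countable; first exact: countableP.
      by move=> [|[|n]] _ //=; exact: countable0.
    by move=> x xAB; split => -[c Ac cx]; apply: xAB; exists c => //;
      [left|right].
  move=> A cA; apply: contrapT => nA; apply: (uncountable_knaster_classes cA).
  move=> a Ca; have [y _ ay] := knaster_class_axis Ca.
  have [c Ac cy] : (\bigcup_(c in A) knaster_class c) y.
    by apply: contrapT => ny; apply: nA; exists y.
  by exists c => //; exact: knaster_class_rat_equiv cy ay.
have [x [_ clx]] := comp _ avoid_proper filterT.
have [c _ cx] := knaster_class_cover x.
have nc : nbhs (x : oT) (knaster_class c).
  by apply: open_nbhs_nbhs; split => //; exact: open_knaster_class.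
have [|w [nw cw]] := clx (avoid [set c]) _ _ nc.
  by exists [set c] => //; exact: countable1.
by apply: nw; exists c.
Qed.

Lemma not_separable_knaster_order : ~ separable oT.
Proof.
move=> [A cA dA].
pose f (x : K) := projT1 (cid2 (knaster_class_cover x)).
have fP x : knaster_class (f x) x by rewrite /f; case: cid2.
apply: (@uncountable_knaster_classes (f @` A)).
  exact: sub_countable (card_image_le _ _) cA.
move=> a Ca; have [y _ ay] := knaster_class_axis Ca.
have [x [ax Ax]] : (knaster_class a `&` A) !=set0.
  by apply: dA; [exists y | exact: open_knaster_class].
exists (f x); first by exists x.
exact: knaster_class_rat_equiv (fP x) ax.
Qed.

End order.
End knaster_classes.

Theorem corollary6p5 (R : realType) (U : set_system nat)
    (UU : UltraFilter U) (npU : nonprincipal U)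
    (D : nat -> chain (knaster R))
    (cD : forall n, covers (D n))
    (D0 : forall n, link (D n) ord0 (knaster_origin R))
    (mD : mesh (D n) @[n --> \oo] --> 0%E) :
  let T : topologicalType := order_topology (ultra_ordered UU npU cD mD) in
  [/\ metrizable R T, ~ connected [set: T], ~ compact [set: T] & ~ separable T].
Proof.
move=> T; split.
- apply: (@order_metrizable R (knaster R) _
    (order_topology (ultra_ordered UU npU cD mD)) (fun x => x)) => //.
  exact: (continuous_order_topology D0).
- exact: not_connected_knaster_order.
- exact: not_compact_knaster_order.
- exact: not_separable_knaster_order.
Qed.
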